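(* For all $n \in \mathbb{Z}^+$ and for all $s \in \mathbb{Z}^+$ with $1 \leq s \leq n-1$, there is an $s$-overlap cycle for $\mathcal{W}(n)$.
   Context: $\mathcal{W}(n)$ denotes the set of weak orders on $[n]$ (transitive and complete relations), represented as words: $\mathcal{W}(n)$ is the set of all words $w_1w_2\ldots w_n$ of length $n$ over the nonnegative integers such that $\{w_1,\dots,w_n\} = \{0,1,\dots,h\}$ for some $h$ with $0 \le h \le n-1$ (here $w_j$ is the height of element $j$ in the weak order). An $s$-overlap cycle ($s$-ocycle) for a set of words of length $n$ is a cyclically ordered listing of the words in the set, each appearing exactly once, such that the last $s$ letters of each word are the first $s$ letters (in the same order) of its successor in the listing (the successor of the last word being the first word). *)

(* Defs.v *)
From mathcomp Require Import all_boot.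

Set Implicit Arguments.
Unset Strict Implicit.
Unset Printing Implicit Defensive.

(* A weak order on [n] is the word of the heights of its elements:
   the letter at (0-based) position j is the height of element j + 1. *)
Definition weak_order (n : nat) (w : n.-tuple nat) : Prop :=
  exists2 h, h <= n - 1 & forall k, (k \in w) = (k <= h).

Definition overlap (n s : nat) : rel (n.-tuple nat) :=
  fun v w => drop (n - s) v == take s w.

(* [cycle] also relates the last word of [c] to its first one. *)
Definition is_ocycle (n s : nat) (W : n.-tuple nat -> Prop)
    (c : seq (n.-tuple nat)) : Prop :=
  [/\ uniq c, forall w, w \in c <-> W w & cycle (overlap s) c].

(* Main.v *)
Require Import Defs.
From mathcomp Require Import all_boot.

Set Implicit Arguments.
Unset Strict Implicit.
Unset Printing Implicit Defensive.

(* Overlapping words are joined by an arrow. Rotation by n - s sends every word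
   to a successor, so it splits W(n) into disjoint cycles. Two words with the
   same last s letters have the same successors, so disjoint cycles through
   them can be spliced into one. Hence a maximal rotation-invariant cycle is
   closed under changing one of the first n - s letters and, after rotating,
   under changing any single letter. Repeatedly replacing an occurrence of the
   largest letter by 0 stays inside W(n) and ends at the word 0...0; so such a
   cycle containing 0...0 is all of W(n). *)

(** Cut each cycle just after [x], resp. [y], and exchange the tails: since [x] and [y] have the
    same successors, each may be followed by what followed the other. *)
Lemma cycle_splice (T : eqType) (e : rel T) (c d : seq T) (x y : T) :
  e x =1 e y -> x \in c -> y \in d -> cycle e c -> cycle e d ->
  exists2 b, perm_eq b (c ++ d) & cycle e b.
Proof.
move=> exy /rot_to[i p cE] /rot_to[j q dE].
rewrite -[cycle e c](rot_cycle i) -[cycle e d](rot_cycle j) cE dE /= => xpx yqy.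
have eq_path r : path e x r = path e y r by case: r => //= z r; rewrite exy.
exists (x :: q ++ y :: p); last first.
  by rewrite /= rcons_cat -cat_rcons cat_path last_rcons -eq_path xpx eq_path yqy.
apply: (@perm_trans _ (rot i c ++ rot j d)).
  by rewrite cE dE /= perm_cons perm_catC perm_sym -cat_rcons -cats1 -catA perm_catCA.
by apply: perm_cat; rewrite perm_rot.
Qed.

(** Start from the [f]-orbit of [x0]. While some [y] of [W] outside [c] has the same successors as a
    member of [c], splice in the orbit of [y]. Once no such [y] is left, the last hypothesis shows
    that [c] exhausts [W]. *)
Lemma cycle_of_closed (T : finType) (e : rel T) (f : T -> T) (W : {pred T})
    (x0 : T) :
  injective f -> (forall x, e x (f x)) -> fclosed f W -> x0 \in W ->
  (forall c : seq T, x0 \in c -> fclosed f c ->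
     (forall x y, e x =1 e y -> y \in W -> x \in c -> y \in c) ->
     {subset W <= c}) ->
  exists c, [/\ uniq c, c =i W & cycle e c].
Proof.
move=> f_inj ef fW Wx0 closed_full.
have orbit_cycle x : cycle e (orbit f x).
  by apply: sub_cycle (cycle_orbit f_inj x) => y _ /eqP <-.
have orbit_closed x : fclosed f (orbit f x).
  move=> y z yz; rewrite -!fconnect_orbit.
  by apply: same_connect_r (connect1 yz) _; apply: fconnect_sym.
have orbit_sub x : x \in W -> {subset orbit f x <= W}.
  by move=> Wx y; rewrite -fconnect_orbit => /(closed_connect fW) <-.
have orbit_mem x : x \in orbit f x by rewrite -fconnect_orbit connect0.
(* [k] is fuel for the splicing: each splice lengthens [c], and a duplicate-free list cannot be
   longer than [#|T|]. *)
suff grow k (c : seq T) : #|T| < size c + k -> x0 \in c -> uniq c ->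
    cycle e c -> fclosed f c -> {subset c <= W} ->
    exists c, [/\ uniq c, c =i W & cycle e c].
  apply: (grow #|T|.+1 (orbit f x0)) => //; rewrite ?orbit_uniq //.
    by rewrite addnS ltnS leq_addl.
  exact: orbit_sub.
elim: k c => [|k IHk] c szc x0c uc ec fc cW.
  by move: szc; rewrite addn0 -(card_uniqP uc) ltnNge max_card.
have [[x y] /= /and4P[/forallP exy Wy xc yNc]|full] :=
    pickP [pred xy : T * T | [&& [forall z, e xy.1 z == e xy.2 z],
                              xy.2 \in W, xy.1 \in c & xy.2 \notin c]].
  have {}exy : e x =1 e y by move=> z; apply/eqP.
  have [b bE eb] := cycle_splice exy xc (orbit_mem y) ec (orbit_cycle y).
  have mem_b z : (z \in b) = (z \in c) || (z \in orbit f y).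
    by rewrite (perm_mem bE) mem_cat.
  apply: (IHk b) => //.
  - apply: leq_trans szc _; rewrite (perm_size bE) size_cat addnS -addSn.
    by rewrite leq_add2r -addn1 leq_add2l size_orbit order_gt0.
  - by rewrite mem_b x0c.
  - rewrite (perm_uniq bE) cat_uniq uc orbit_uniq andbT /=.
    (* As [c] is closed under [f], meeting the orbit of [y] would put [y] itself in [c]. *)
    apply/hasPn => z; rewrite -fconnect_orbit => /(closed_connect fc) yz.
    by rewrite /= -yz.
  - by move=> z t zt; rewrite !mem_b (fc _ _ zt) (orbit_closed y _ _ zt).
  - by move=> z; rewrite mem_b => /orP[/cW|/(orbit_sub y Wy)].
exists c; split=> // z; apply/idP/idP => [/cW//|].
apply: closed_full => // x y exy Wy xc.
apply: contraFT (full (x, y)) => yNc; rewrite /= Wy xc yNc !andbT.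
by apply/forallP => t; rewrite exy.
Qed.

(** Bounded letters make the words of a given length a finite type. For a nonempty word, a
    down-closed set of letters is some [{0, ..., h}], as in a weak order. *)
Definition letters_downset (n : nat) (w : seq 'I_n) : bool :=
  [forall k in w, forall j : 'I_n, (j <= k) ==> (j \in w)].

Lemma letters_downsetP (n : nat) (w : seq 'I_n) :
  reflect (forall k j : 'I_n, k \in w -> j <= k -> j \in w)
          (letters_downset w).
Proof.
apply: (iffP forall_inP) => [w_down k j kw|w_down k kw].
  by move/forallP: (w_down k kw) => /(_ j) /implyP.
by apply/forallP => j; apply/implyP; apply: w_down.
Qed.

Lemma eq_letters_downset (n : nat) (v w : seq 'I_n) :
  v =i w -> letters_downset v = letters_downset w.
Proof.
by move=> vw; apply/letters_downsetP/letters_downsetP => down k j;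
  [rewrite -!vw | rewrite !vw]; apply: down.
Qed.

(** Only the letter [h] can be lost. If a remaining letter [k] requires it, then [k = h] by
    maximality, so [h] still occurs. *)
Lemma letters_downset_lower_max (n : nat) (a b : seq 'I_n.+1) (h : 'I_n.+1) :
  (forall k, k \in a ++ h :: b -> k <= h) ->
  letters_downset (a ++ h :: b) -> letters_downset (a ++ ord0 :: b).
Proof.
move=> h_max /letters_downsetP down; apply/letters_downsetP => k j kw jk.
have [->|j0] := eqVneq j ord0; first by rewrite mem_cat inE eqxx orbT.
have kh : k \in a ++ h :: b.
  move: kw; rewrite !mem_cat !inE => /or3P[->//|/eqP k0|->]; rewrite ?orbT //.
  by move: jk j0; rewrite k0 leqn0 -val_eqE /= => ->.
have := down _ _ kh jk; rewrite !mem_cat !inE => /or3P[->//|/eqP jh|->];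
  rewrite ?orbT //.
have kj : k = j by apply/val_inj/eqP; rewrite eqn_leq jk jh h_max.
by move: kw; rewrite kj mem_cat inE.
Qed.

Lemma rot_tuple_inj (n m : nat) (T : Type) :
  injective (@rot_tuple n m T).
Proof. by move=> v w /(congr1 val) /rot_inj /val_inj. Qed.

Section ClosedClass.

Variables (n m : nat) (c : seq (n.+1.-tuple 'I_n.+1)).
Hypotheses (m_gt0 : 0 < m) (c_rot : fclosed (@rot_tuple _ m _) c).
Hypothesis c_drop : forall v w : n.+1.-tuple 'I_n.+1,
  drop m v = drop m w -> letters_downset w -> v \in c -> w \in c.

(** Induction on the position [size a] of the changed letter: below [m], [drop m] erases the
    difference; otherwise rotating both words by [m] lowers the position by [m]. *)
Lemma closed_change_letter (a b : seq 'I_n.+1) (x y : 'I_n.+1)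
    (v w : n.+1.-tuple 'I_n.+1) :
  val v = a ++ x :: b -> val w = a ++ y :: b -> letters_downset w ->
  v \in c -> w \in c.
Proof.
have [k] := ubnP (size a); elim: k => // k IHk in a b v w *.
move=> szk vE wE w_down vc; have [am|ma] := ltnP (size a) m.
  by apply: c_drop vc => //; rewrite vE wE !drop_cat ltnNge (ltnW am) /= -subnSK.
have rotE z (u : n.+1.-tuple _) : val u = a ++ z :: b ->
    val (rot_tuple m u) = drop m a ++ z :: (b ++ take m a).
  move=> /= ->; rewrite -{1}(cat_take_drop m a) -catA -{1}(size_takel ma).
  by rewrite rot_size_cat -catA.
rewrite (c_rot (eqxx (rot_tuple m w))).
apply: (IHk _ _ _ _ _ (rotE _ _ vE) (rotE _ _ wE)).
- rewrite size_drop -ltnS; apply: leq_trans szk.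
  by rewrite ltnS ltn_subrL m_gt0 (leq_trans m_gt0).
- by rewrite (@eq_letters_downset _ _ w) // => z; rewrite mem_rot.
- by rewrite -(c_rot (eqxx (rot_tuple m v))).
Qed.

(** Induction on the number of nonzero letters: lowering a largest letter [h] to 0 gives a word
    already in [c], and changing that 0 back to [h] stays in [c]. *)
Lemma mem_closed_class (w : n.+1.-tuple 'I_n.+1) :
  nseq_tuple n.+1 ord0 \in c -> letters_downset w -> w \in c.
Proof.
move=> c0; have [k] := ubnP (count (predC1 ord0) w); elim: k => // k IHk in w *.
move=> szk w_down; have [/all_pred1P|/allPn[x xw xN0]] := boolP (all (pred1 ord0) w).
  rewrite size_tuple => w0.
  by have -> : w = nseq_tuple n.+1 ord0 by apply: val_inj.
case: (@arg_maxnP _ x (mem w) val xw) => h hw h_max.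
have hN0 : h != ord0.
  by move: xN0; rewrite /= -!val_eqE /= -!lt0n => /leq_trans; apply; apply: h_max.
case/splitPr wE: {1}(val w) / hw => [a b].
have szv : size (a ++ ord0 :: b) == n.+1.
  by rewrite -[X in _ == X](size_tuple w) wE !size_cat.
apply: (@closed_change_letter a b ord0 h (Tuple szv)) => //.
apply: IHk => /=.
  by move: szk; rewrite wE !count_cat /= hN0 add0n add1n addnS.
by apply: (@letters_downset_lower_max _ _ _ h); rewrite -wE.
Qed.

End ClosedClass.

Lemma weak_order_downset (n : nat) (w : n.+1.-tuple 'I_n.+1) :
  weak_order (map_tuple val w) <-> letters_downset w.
Proof.
have mem_w (k : 'I_n.+1) : (val k \in map_tuple val w) = (k \in w).
  by rewrite mem_map //; apply: val_inj.
split=> [[h _ wE]|/letters_downsetP w_down].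
  by apply/letters_downsetP => k j; rewrite -!mem_w !wE => kh /leq_trans; apply.
(* The height of the weak order is its largest letter; the first letter witnesses that there is
   one. *)
case: (@arg_maxnP _ (thead w) (mem w) val (mem_tnth _ _)) => h hw h_max.
exists h; first by rewrite subn1 -ltnS.
move=> k; apply/mapP/idP => [[j jw ->]|kh]; first exact: h_max.
have kE : nat_of_ord (inord k : 'I_n.+1) = k.
  by rewrite inordK // (leq_ltn_trans kh).
by exists (inord k) => //; apply: w_down hw _; rewrite kE.
Qed.

(** All heights are at most [n], so [inord] alters no letter. *)
Lemma weak_order_ord (n : nat) (w : n.+1.-tuple nat) :
  weak_order w -> exists v : n.+1.-tuple 'I_n.+1, w = map_tuple val v.
Proof.
rewrite /weak_order subn1 => -[h hn wE]; exists (map_tuple inord w).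
apply: val_inj; rewrite /= -map_comp -[LHS]map_id; apply/eq_in_map => k.
by rewrite wE /= => kh; rewrite inordK // ltnS (leq_trans kh).
Qed.

Theorem theorem4p1 (n s : nat) (n_gt0 : 0 < n) (s_gt0 : 1 <= s)
    (s_le : s <= n - 1) :
  exists c : seq (n.-tuple nat), is_ocycle s (@weak_order n) c.
Proof.
case: n => // n in n_gt0 s_le *; rewrite subn1 /= in s_le.
have m_gt0 : 0 < n.+1 - s by rewrite subn_gt0.
pose e (v w : n.+1.-tuple 'I_n.+1) := drop (n.+1 - s) v == take s w.
have e_rot v : e v (rot_tuple (n.+1 - s) v).
  rewrite /e /rot /= take_size_cat // size_drop size_tuple subKn //.
  exact: leqW.
have [|||c [uc cW ec]] := @cycle_of_closed _ e (@rot_tuple _ (n.+1 - s) _)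
    [pred w | letters_downset (tval w)] (nseq_tuple n.+1 ord0)
    (@rot_tuple_inj _ _ _) e_rot.
- move=> v _ /eqP <-; rewrite !inE; apply: eq_letters_downset => z.
  by rewrite mem_rot.
- rewrite inE; apply/letters_downsetP => k j; rewrite /tval !(@mem_nseq _ n.+1) /=.
  by move=> /eqP ->; rewrite leqn0.
- move=> c c0 c_rot c_eq w w_down; apply: mem_closed_class m_gt0 c_rot _ _ c0 w_down.
  (* The successors of a word under [e] depend only on its last [s] letters. *)
  by move=> v u vu; apply: c_eq => t; rewrite /e vu.
exists (map (map_tuple val) c); split.
- rewrite map_inj_uniq // => v w /(congr1 val) /= /inj_map vw.
  by apply/val_inj/vw/val_inj.
- move=> w; split=> [/mapP[v + ->]|wW].
    by rewrite cW => /weak_order_downset.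
  have [v vE] := weak_order_ord wW; rewrite vE in wW *.
  by apply: map_f; rewrite cW; apply/weak_order_downset.
- apply: homo_cycle ec => v w /eqP vw.
  by rewrite /overlap /= -map_drop vw map_take.
Qed.
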